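(* Let $C$ be an étale topological category. Then $\Omega(C)$ is a restriction quantal frame.
   Context: Étale topological category: a small category $C$ (arrows, identities $C_o$, domain/codomain maps $\mathbf{d},\mathbf{r}$, $ab$ defined iff $\mathbf{d}(a)=\mathbf{r}(b)$) with a topology making $\mathbf{d}$, $\mathbf{r}$ and multiplication on $\{(a,b):\mathbf{d}(a)=\mathbf{r}(b)\}\subseteq C\times C$ continuous, such that $\mathbf{d}$ and $\mathbf{r}$ are local homeomorphisms. $\Omega(C)$: the open subsets of $C$ ordered by inclusion, with product $UV=\{uv:u\in U,v\in V,\mathbf{d}(u)=\mathbf{r}(v)\}$, identity $C_o$, $U^{\ast}=\mathbf{d}(U)$, $U^{+}=\mathbf{r}(U)$. An Ehresmann semigroup is a semigroup $S$ with a commutative subsemigroup $P$ of idempotents (projections) and unary operations $a\mapsto a^{\ast}$, $a\mapsto a^{+}$ with values in $P$, which are the identity on $P$, satisfying $aa^{\ast}=a$, $a^{+}a=a$, $(ab)^{\ast}=(a^{\ast}b)^{\ast}$, $(ab)^{+}=(ab^{+})^{+}$. A quantal frame is a frame $(Q,\le)$ with an associative multiplication distributing over arbitrary joins on both sides. A restriction quantal frame is a quantal frame $Q$ which is a monoid with identity $e$ and an Ehresmann semigroup with set of projections $e^{\downarrow}=\{x:x\le e\}$, with $\ast$ and $+$ preserving arbitrary joins, such that the top element $1$ is a join of partial isometries and the product of any two partial isometries is a partial isometry; here $a$ is a partial isometry if $b\le a$ implies $b=b^{+}a=ab^{\ast}$. *)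

(* Defs.v *)
From HB Require Import structures.
From mathcomp Require Import all_boot all_order.
From mathcomp Require Import all_classical all_reals all_analysis.
Set Implicit Arguments. Unset Strict Implicit. Unset Printing Implicit Defensive.
Local Open Scope classical_set_scope.

(* Local homeomorphism: every point has an open neighbourhood U on which f is
   injective, with f(U) open and f restricted to U an open map (continuity of f
   is assumed separately), i.e. f|_U : U -> f(U) is a homeomorphism onto an
   open set. *)
Definition local_homeo {T U : topologicalType} (f : T -> U) : Prop :=
  continuous f /\
  forall x : T, exists W : set T,
    [/\ open W, W x, open (f @` W),
        (forall a b, W a -> W b -> f a = f b -> a = b) &
        (forall V : set T, open V -> V `<=` W -> open (f @` V))].

(* Small category given by its arrows C, the set Co of identities, domain
   and codomain maps dom, cod, and multiplication mul (ab is defined iff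
   dom a = cod b; mul is an arbitrary total extension). *)
Definition composable {C : Type} (dom cod : C -> C) : set (C * C) :=
  [set p | dom p.1 = cod p.2].

Definition is_small_category {C : Type} (Co : set C) (dom cod : C -> C)
  (mul : C -> C -> C) : Prop :=
  [/\ (forall a, Co (dom a) /\ Co (cod a)),
      (forall e, Co e -> dom e = e /\ cod e = e),
      (forall a, mul a (dom a) = a /\ mul (cod a) a = a),
      (forall a b, dom a = cod b -> dom (mul a b) = dom b /\ cod (mul a b) = cod a) &
      (forall a b c, dom a = cod b -> dom b = cod c ->
         mul (mul a b) c = mul a (mul b c))].

Definition is_etale_category {C : topologicalType} (Co : set C)
  (dom cod : C -> C) (mul : C -> C -> C) : Prop :=
  [/\ is_small_category Co dom cod mul,
      {within composable dom cod, continuous (fun p : C * C => mul p.1 p.2)},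
      local_homeo dom & local_homeo cod].

Definition set_prod {C : Type} (dom cod : C -> C) (mul : C -> C -> C)
  (U V : set C) : set C :=
  [set x | exists u v, [/\ U u, V v, dom u = cod v & x = mul u v]].

Definition Omega (C : topologicalType) := {U : set C | open U}.

Section Abstract.
Variables (Q : Type) (le : Q -> Q -> Prop).

Definition is_lub (S : set Q) (j : Q) : Prop :=
  (forall s, S s -> le s j) /\ (forall u, (forall s, S s -> le s u) -> le j u).

Definition is_glb2 (a b m : Q) : Prop :=
  [/\ le m a, le m b & forall u, le u a -> le u b -> le u m].

Definition is_frame : Prop :=
  [/\ ((forall a, le a a) /\
       (forall a b c, le a b -> le b c -> le a c) /\
       (forall a b, le a b -> le b a -> a = b)),
      (forall S : set Q, exists j, is_lub S j),
      (forall a b, exists m, is_glb2 a b m) &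
      (forall a (S : set Q) j m, is_lub S j -> is_glb2 a j m ->
         is_lub [set x | exists2 s, S s & is_glb2 a s x] m)].

Variable mul : Q -> Q -> Q.

Definition is_quantal_frame : Prop :=
  [/\ is_frame,
      (forall a b c, mul (mul a b) c = mul a (mul b c)) &
      (forall a (S : set Q) j, is_lub S j ->
         is_lub [set mul a s | s in S] (mul a j) /\
         is_lub [set mul s a | s in S] (mul j a))].

Variables (e : Q) (star plus : Q -> Q).

Definition projection (p : Q) : Prop := le p e.

Definition is_ehresmann (P : set Q) : Prop :=
  [/\ ((forall p q, P p -> P q -> P (mul p q) /\ mul p q = mul q p) /\
       (forall p, P p -> mul p p = p)),
      (forall a, P (star a) /\ P (plus a)),
      (forall p, P p -> star p = p /\ plus p = p),
      (forall a, mul a (star a) = a /\ mul (plus a) a = a) &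
      (forall a b, star (mul a b) = star (mul (star a) b) /\
                   plus (mul a b) = plus (mul a (plus b)))].

Definition partial_isometry (a : Q) : Prop :=
  forall b, le b a -> b = mul (plus b) a /\ b = mul a (star b).

Definition is_restriction_quantal_frame : Prop :=
  [/\ (is_quantal_frame /\
       (forall a, mul e a = a /\ mul a e = a)),
      is_ehresmann projection,
      (forall (S : set Q) j, is_lub S j ->
         is_lub (star @` S) (star j) /\ is_lub (plus @` S) (plus j)),
      (exists top, (forall x, le x top) /\ is_lub partial_isometry top) &
      (forall a b, partial_isometry a -> partial_isometry b ->
         partial_isometry (mul a b))].

End Abstract.

(* Main.v *)
Require Import Defs.
From mathcomp Require Import all_boot all_order.
From mathcomp Require Import all_classical all_reals all_analysis.
Set Implicit Arguments. Unset Strict Implicit. Unset Printing Implicit Defensive.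
Local Open Scope classical_set_scope.

(* The open sets of C form a frame, and the product UV is open because [dom]
   is a local homeomorphism and multiplication is continuous; it distributes
   over unions by construction. The Ehresmann identities are identities
   between sets of arrows valid in any small category. The partial isometries
   of Omega(C) are exactly the open bisections, the open sets on which [dom]
   and [cod] are injective: every open subset B of a bisection A satisfies
   B = cod(B) A = A dom(B), and conversely restricting a partial isometry to
   a neighbourhood on which [dom] (resp. [cod]) is injective forces global
   injectivity. Open bisections cover C, as [dom] and [cod] are local
   homeomorphisms, and they are closed under products. *)

Section SetProd.
Variables (C : Type) (dom cod : C -> C) (mul : C -> C -> C).
Local Notation prod := (set_prod dom cod mul).

Lemma set_prod_bigcupl I (D : set I) (F : I -> set C) V :
  prod (\bigcup_(i in D) F i) V = \bigcup_(i in D) prod (F i) V.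
Proof.
apply/seteqP; split=> [_ [u [v [[i Di Fu] Vv duv ->]]]|_ [i Di [u [v [Fu Vv duv ->]]]]].
- by exists i => //; exists u, v.
- by exists u, v; split => //; exists i.
Qed.

Lemma set_prod_bigcupr I (D : set I) (F : I -> set C) U :
  prod U (\bigcup_(i in D) F i) = \bigcup_(i in D) prod U (F i).
Proof.
apply/seteqP; split=> [_ [u [v [Uu [i Di Fv] duv ->]]]|_ [i Di [u [v [Uu Fv duv ->]]]]].
- by exists i => //; exists u, v.
- by exists u, v; split => //; exists i.
Qed.

End SetProd.

Section SmallCategory.
Variables (C : Type) (Co : set C) (dom cod : C -> C) (mul : C -> C -> C).
Hypothesis cat : is_small_category Co dom cod mul.
Local Notation prod := (set_prod dom cod mul).

Lemma dom_Co a : Co (dom a). Proof. by case: cat => /(_ a)[]. Qed.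
Lemma cod_Co a : Co (cod a). Proof. by case: cat => /(_ a)[]. Qed.
Lemma dom_id e : Co e -> dom e = e. Proof. by case: cat => _ /(_ e) h _ _ _ /h[]. Qed.
Lemma cod_id e : Co e -> cod e = e. Proof. by case: cat => _ /(_ e) h _ _ _ /h[]. Qed.
Lemma mul_dom a : mul a (dom a) = a. Proof. by case: cat => _ _ /(_ a)[]. Qed.
Lemma mul_cod a : mul (cod a) a = a. Proof. by case: cat => _ _ /(_ a)[]. Qed.

Lemma dom_mul a b : dom a = cod b -> dom (mul a b) = dom b.
Proof. by case: cat => _ _ _ h _ /h[]. Qed.

Lemma cod_mul a b : dom a = cod b -> cod (mul a b) = cod a.
Proof. by case: cat => _ _ _ h _ /h[]. Qed.

Lemma mulA a b c : dom a = cod b -> dom b = cod c ->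
  mul (mul a b) c = mul a (mul b c).
Proof. by case: cat => _ _ _ _; apply. Qed.

Lemma dom_dom a : dom (dom a) = dom a. Proof. exact: dom_id (dom_Co a). Qed.
Lemma cod_dom a : cod (dom a) = dom a. Proof. exact: cod_id (dom_Co a). Qed.
Lemma dom_cod a : dom (cod a) = cod a. Proof. exact: dom_id (cod_Co a). Qed.
Lemma cod_cod a : cod (cod a) = cod a. Proof. exact: cod_id (cod_Co a). Qed.

Lemma set_prodA U V W : prod (prod U V) W = prod U (prod V W).
Proof.
apply/seteqP; split=> x.
- move=> [_ [w [[u [v [Uu Vv duv ->]]] Ww dw ->]]].
  rewrite dom_mul // in dw.
  exists u, (mul v w); split => //; first by exists v, w.
  + by rewrite cod_mul.
  + by rewrite mulA.
- move=> [u [_ [Uu [v [w [Vv Ww dvw ->]]] du ->]]].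
  rewrite cod_mul // in du.
  exists (mul u v), w; split => //; first by exists u, v.
  + by rewrite dom_mul.
  + by rewrite mulA.
Qed.

Lemma set_prod_idl U : prod Co U = U.
Proof.
apply/seteqP; split=> [_ [e [u [Ce Uu deu ->]]]|x Ux].
- by rewrite -(dom_id Ce) deu mul_cod.
- by exists (cod x), x; split; [exact: cod_Co | | rewrite dom_cod | rewrite mul_cod].
Qed.

Lemma set_prod_idr U : prod U Co = U.
Proof.
apply/seteqP; split=> [_ [u [e [Uu Ce due ->]]]|x Ux].
- by rewrite -(cod_id Ce) -due mul_dom.
- by exists x, (dom x); split; [| exact: dom_Co | rewrite cod_dom | rewrite mul_dom].
Qed.

Lemma set_prod_subCo U V : U `<=` Co -> V `<=` Co -> prod U V = U `&` V.
Proof.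
move=> UCo VCo; apply/seteqP; split=> [_ [u [v [Uu Vv duv ->]]]|x [Ux Vx]].
- have uv : u = v by rewrite -(dom_id (UCo _ Uu)) duv (cod_id (VCo _ Vv)).
  subst v; have -> : mul u u = u by rewrite -{2}(dom_id (UCo _ Uu)) mul_dom.
  by split.
- exists x, x; split => //; first by rewrite (dom_id (UCo _ Ux)) (cod_id (UCo _ Ux)).
  by rewrite -{3}(dom_id (UCo _ Ux)) mul_dom.
Qed.

Lemma image_dom_subCo U : U `<=` Co -> dom @` U = U.
Proof.
move=> UCo; apply/seteqP; split=> [_ [u Uu <-]|x Ux].
- by rewrite (dom_id (UCo _ Uu)).
- by exists x; rewrite // (dom_id (UCo _ Ux)).
Qed.

Lemma image_cod_subCo U : U `<=` Co -> cod @` U = U.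
Proof.
move=> UCo; apply/seteqP; split=> [_ [u Uu <-]|x Ux].
- by rewrite (cod_id (UCo _ Uu)).
- by exists x; rewrite // (cod_id (UCo _ Ux)).
Qed.

Lemma set_prod_image_dom_subset A B : set_inj A dom -> B `<=` A ->
  prod A (dom @` B) = B.
Proof.
move=> injA BA; apply/seteqP; split=> [_ [u [_ [Au [w Bw <-] du ->]]]|x Bx].
- rewrite cod_dom in du.
  by rewrite (injA _ _ (mem_set Au) (mem_set (BA _ Bw)) du) mul_dom.
- by exists x, (dom x); split; [exact: BA | exists x | rewrite cod_dom | rewrite mul_dom].
Qed.

Lemma set_prod_image_cod_subset A B : set_inj A cod -> B `<=` A ->
  prod (cod @` B) A = B.
Proof.
move=> injA BA; apply/seteqP; split=> [_ [_ [u [[w Bw <-] Au du ->]]]|x Bx].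
- rewrite dom_cod in du.
  by rewrite (injA _ _ (mem_set Au) (mem_set (BA _ Bw)) (esym du)) mul_cod.
- by exists (cod x), x; split; [exists x | exact: BA | rewrite dom_cod | rewrite mul_cod].
Qed.

Lemma set_prod_image_dom U : prod U (dom @` U) = U.
Proof.
apply/seteqP; split=> [_ [u [_ [Uu [w Uw <-] du ->]]]|x Ux].
- by rewrite cod_dom in du; rewrite -du mul_dom.
- by exists x, (dom x); split; [| exists x | rewrite cod_dom | rewrite mul_dom].
Qed.

Lemma set_prod_image_cod U : prod (cod @` U) U = U.
Proof.
apply/seteqP; split=> [_ [_ [u [[w Uw <-] Uu du ->]]]|x Ux].
- by rewrite dom_cod in du; rewrite du mul_cod.
- by exists (cod x), x; split; [exists x | | rewrite dom_cod | rewrite mul_cod].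
Qed.

Lemma image_dom_set_prod U V : dom @` prod U V = dom @` prod (dom @` U) V.
Proof.
apply/seteqP; split.
- move=> _ [_ [u [v [Uu Vv duv ->]]] <-].
  exists (mul (dom u) v); last by rewrite !dom_mul // dom_dom.
  by exists (dom u), v; split; [exists u | | rewrite dom_dom |].
- move=> _ [_ [_ [v [[u Uu <-] Vv duv ->]]] <-].
  rewrite dom_dom in duv; rewrite dom_mul ?dom_dom //.
  by exists (mul u v); [exists u, v | rewrite dom_mul].
Qed.

Lemma image_cod_set_prod U V : cod @` prod U V = cod @` prod U (cod @` V).
Proof.
apply/seteqP; split.
- move=> _ [_ [u [v [Uu Vv duv ->]]] <-].
  exists (mul u (cod v)); last by rewrite !cod_mul // cod_cod.
  by exists u, (cod v); split; [| exists v | rewrite cod_cod |].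
- move=> _ [_ [u [_ [Uu [v Vv <-] duv ->]]] <-].
  rewrite cod_cod in duv; rewrite cod_mul ?cod_cod //.
  by exists (mul u v); [exists u, v | rewrite cod_mul].
Qed.

Lemma set_inj_dom_set_prod A B : set_inj A dom -> set_inj B dom ->
  set_inj (prod A B) dom.
Proof.
move=> injA injB _ _ /set_mem[u [v [Au Bv duv ->]]] /set_mem[u' [v' [Au' Bv' duv' ->]]].
rewrite !dom_mul // => /(injB _ _ (mem_set Bv) (mem_set Bv')) vv'; subst v'.
by rewrite (injA _ _ (mem_set Au) (mem_set Au')) // duv duv'.
Qed.

Lemma set_inj_cod_set_prod A B : set_inj A cod -> set_inj B cod ->
  set_inj (prod A B) cod.
Proof.
move=> injA injB _ _ /set_mem[u [v [Au Bv duv ->]]] /set_mem[u' [v' [Au' Bv' duv' ->]]].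
rewrite !cod_mul // => /(injA _ _ (mem_set Au) (mem_set Au')) uu'; subst u'.
by rewrite (injB _ _ (mem_set Bv) (mem_set Bv')) // -duv -duv'.
Qed.

End SmallCategory.

Section LocalHomeo.
Variables (T U : topologicalType) (f : T -> U).
Hypothesis lhf : local_homeo f.

Lemma local_homeo_open V : open V -> open (f @` V).
Proof.
move=> oV; have /choice[W hW] := lhf.2.
have -> : f @` V = \bigcup_(x in V) f @` (V `&` W x).
  apply/seteqP; split=> [_ [x Vx <-]|_ [x _ [y [Vy _] <-]]]; last by exists y.
  by exists x => //; exists x => //; split => //; case: (hW x).
apply: bigcup_open => x _; case: (hW x) => oW _ _ _; apply.
  exact: openI.
exact: subIsetr.
Qed.

Lemma local_homeo_locally_inj x : exists W, [/\ open W, W x & set_inj W f].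
Proof.
have [W [oW Wx _ injW _]] := lhf.2 x.
by exists W; split => // a b /set_mem Wa /set_mem Wb; apply: injW.
Qed.

End LocalHomeo.

Lemma within_continuous_open_rect (X Y Z : topologicalType) (A : set (X * Y))
    (g : X * Y -> Z) : {within A, continuous g} ->
  forall p, A p -> forall W, open W -> W (g p) ->
  exists P Q, [/\ open P, open Q, P p.1, Q p.2 &
    forall a b, P a -> Q b -> A (a, b) -> W (g (a, b))].
Proof.
move=> /subspace_continuousP gc p Ap W oW Wgp.
have /(gc p Ap)[[P Q] /= [] ] : nbhs (g p) W by exact: open_nbhs_nbhs.
rewrite !nbhsE => -[P' [oP' P'p] P'P] [Q' [oQ' Q'q] Q'Q] PQW.
exists P', Q'; split => // a b P'a Q'b Aab.
by apply: (PQW (a, b)) => //; split; [exact: P'P | exact: Q'Q].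
Qed.

Section EtaleCategory.
Variables (C : topologicalType) (Co : set C) (dom cod : C -> C) (mul : C -> C -> C).
Hypothesis etale : is_etale_category Co dom cod mul.
Local Notation prod := (set_prod dom cod mul).

Let cat : is_small_category Co dom cod mul. Proof. by case: etale. Qed.
Let dom_lh : local_homeo dom. Proof. by case: etale. Qed.
Let cod_lh : local_homeo cod. Proof. by case: etale. Qed.
Let mul_cont :
  {within composable dom cod, continuous (fun p : C * C => mul p.1 p.2)}.
Proof. by case: etale. Qed.

(* [dom] is injective on a neighbourhood [W] of [u v]; an arrow of [W] with
   the domain of some [b] near [v] composable with some [a] near [u] is then
   [a b], which lies in [W] by continuity of [mul]. *)
Lemma set_prod_open U V : open U -> open V -> open (prod U V).
Proof.
move=> oU oV; rewrite openE => _ [u [v [Uu Vv duv ->]]].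
have [W [oW Wuv injW]] := local_homeo_locally_inj dom_lh (mul u v).
have [P [Q [oP oQ Pu Qv mulPQ]]] :=
  within_continuous_open_rect mul_cont (p := (u, v)) duv oW Wuv.
pose A := P `&` U; pose B := Q `&` V `&` cod @^-1` (dom @` A).
have oB : open B.
  apply: openI; first exact: openI.
  move/continuousP: cod_lh.1; apply.
  exact: (local_homeo_open dom_lh (openI oP oU)).
rewrite /interior nbhsE; exists (W `&` dom @^-1` (dom @` B)).
  split; last by split => //; exists v; [split; [split | exists u] | rewrite (dom_mul cat)].
  apply: openI => //; move/continuousP: dom_lh.1; apply.
  exact: (local_homeo_open dom_lh oB).
move=> y [Wy [b [[Qb Vb] [a [Pa Ua] dab]] dby]].
exists a, b; split => //; apply: injW; rewrite ?inE //; first exact: mulPQ.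
by rewrite (dom_mul cat).
Qed.

Lemma open_Co : open Co.
Proof.
have -> : Co = dom @` setT.
  apply/seteqP; split=> [e Ce|_ [a _ <-]]; last exact: (dom_Co cat).
  by exists e; rewrite // (dom_id cat).
exact: (local_homeo_open dom_lh openT).
Qed.

Lemma set_inj_dom_restrictions A : open A ->
  (forall B, open B -> B `<=` A -> prod A (dom @` B) = B) -> set_inj A dom.
Proof.
move=> oA restr x y /set_mem Ax /set_mem Ay dxy.
have [W [oW Wx injW]] := local_homeo_locally_inj dom_lh x.
have [_ Wy] : (A `&` W) y.
  rewrite -(restr _ (openI oA oW) (@subIsetl _ _ _)).
  by exists y, (dom y); split; [| exists x | rewrite (cod_dom cat) | rewrite (mul_dom cat)].
exact: injW (mem_set Wx) (mem_set Wy) dxy.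
Qed.

Lemma set_inj_cod_restrictions A : open A ->
  (forall B, open B -> B `<=` A -> prod (cod @` B) A = B) -> set_inj A cod.
Proof.
move=> oA restr x y /set_mem Ax /set_mem Ay cxy.
have [W [oW Wx injW]] := local_homeo_locally_inj cod_lh x.
have [_ Wy] : (A `&` W) y.
  rewrite -(restr _ (openI oA oW) (@subIsetl _ _ _)).
  by exists (cod y), y; split; [exists x | | rewrite (dom_cod cat) | rewrite (mul_cod cat)].
exact: injW (mem_set Wx) (mem_set Wy) cxy.
Qed.

End EtaleCategory.

Section OmegaFrame.
Variable C : topologicalType.
Local Notation incl := (fun U V : Omega C => proj1_sig U `<=` proj1_sig V).

Lemma Omega_eq (U V : Omega C) : proj1_sig U = proj1_sig V -> U = V.
Proof. by case: U V => [U oU] [V oV] /= UV; apply: eq_exist. Qed.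

Lemma is_lub_OmegaE (S : set (Omega C)) j :
  is_lub incl S j <-> proj1_sig j = \bigcup_(s in S) proj1_sig s.
Proof.
split=> [[ub least]|jE]; last first.
  split=> [s Ss|u ub]; rewrite /= jE; first by move=> x sx; exists s.
  by move=> x [s Ss /ub]; apply.
have oS : open (\bigcup_(s in S) proj1_sig s).
  by apply: bigcup_open => s _; exact: proj2_sig.
apply/seteqP; split; first by apply: (least (exist _ _ oS)) => s Ss x sx; exists s.
by move=> x [s Ss /ub]; apply.
Qed.

Lemma is_glb2_OmegaE (a b m : Omega C) :
  is_glb2 incl a b m <-> proj1_sig m = proj1_sig a `&` proj1_sig b.
Proof.
split=> [[ma mb greatest]|mE]; last first.
  split=> [|/=|u ua ub]; rewrite /= mE; [exact: subIsetl | exact: subIsetr |].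
  by move=> x ux; split; [exact: ua | exact: ub].
have oI : open (proj1_sig a `&` proj1_sig b) by apply: openI; exact: proj2_sig.
apply/seteqP; split=> [x mx|]; first by split; [exact: ma | exact: mb].
by apply: (greatest (exist _ _ oI)) => x [].
Qed.

Lemma Omega_frame : is_frame incl.
Proof.
split.
- split; first by move=> a.
  split=> [a b c ab bc|a b ab ba]; first exact: subset_trans ab bc.
  by apply: Omega_eq; apply/seteqP.
- move=> S; have oS : open (\bigcup_(s in S) proj1_sig s).
    by apply: bigcup_open => s _; exact: proj2_sig.
  by exists (exist _ _ oS); apply/is_lub_OmegaE.
- move=> a b; have oI : open (proj1_sig a `&` proj1_sig b).
    by apply: openI; exact: proj2_sig.
  by exists (exist _ _ oI); apply/is_glb2_OmegaE.
- move=> a S j m /is_lub_OmegaE jE /is_glb2_OmegaE mE; apply/is_lub_OmegaE.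
  rewrite mE jE; apply/seteqP; split=> [x [ax [s Ss sx]]|x [_ [s Ss /is_glb2_OmegaE ->] []]].
  + have oI : open (proj1_sig a `&` proj1_sig s) by apply: openI; exact: proj2_sig.
    by exists (exist _ _ oI) => //; exists s => //; apply/is_glb2_OmegaE.
  + by move=> ax sx; split => //; exists s.
Qed.

End OmegaFrame.

Section OmegaRestrictionQuantalFrame.
Variables (C : topologicalType) (Co : set C) (dom cod : C -> C) (mul : C -> C -> C).
Hypothesis etale : is_etale_category Co dom cod mul.
Local Notation incl := (fun U V : Omega C => proj1_sig U `<=` proj1_sig V).

Let cat : is_small_category Co dom cod mul. Proof. by case: etale. Qed.
Let dom_lh : local_homeo dom. Proof. by case: etale. Qed.
Let cod_lh : local_homeo cod. Proof. by case: etale. Qed.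

Definition Omega_mul (U V : Omega C) : Omega C :=
  exist _ _ (set_prod_open etale (proj2_sig U) (proj2_sig V)).
Definition Omega_id : Omega C := exist _ _ (open_Co etale).
Definition Omega_dom (U : Omega C) : Omega C :=
  exist _ _ (local_homeo_open dom_lh (proj2_sig U)).
Definition Omega_cod (U : Omega C) : Omega C :=
  exist _ _ (local_homeo_open cod_lh (proj2_sig U)).
Arguments Omega_mul U V /.
Arguments Omega_dom U /.
Arguments Omega_cod U /.

Local Notation pi := (partial_isometry incl Omega_mul Omega_dom Omega_cod).

Lemma Omega_quantal_frame : is_quantal_frame incl Omega_mul.
Proof.
split; first exact: Omega_frame.
  by move=> a b c; apply: Omega_eq; exact: (set_prodA cat).
move=> a S j /is_lub_OmegaE jE; split; apply/is_lub_OmegaE; rewrite /= jE bigcup_image.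
- exact: set_prod_bigcupr.
- exact: set_prod_bigcupl.
Qed.

Lemma Omega_mul_id a : Omega_mul Omega_id a = a /\ Omega_mul a Omega_id = a.
Proof.
by split; apply: Omega_eq; [exact: (set_prod_idl cat) | exact: (set_prod_idr cat)].
Qed.

Lemma Omega_ehresmann :
  is_ehresmann Omega_mul Omega_dom Omega_cod (projection incl Omega_id).
Proof.
have image_sub f U : (forall a, Co (f a)) -> f @` U `<=` Co by move=> fCo _ [a _ <-].
split.
- split=> [p q /= pCo qCo|p /= pCo]; last first.
    by apply: Omega_eq; rewrite /= (set_prod_subCo cat pCo pCo) setIid.
  split; first by rewrite /projection /= (set_prod_subCo cat pCo qCo) => x [/pCo].
  apply: Omega_eq; rewrite /= (set_prod_subCo cat pCo qCo).
  by rewrite (set_prod_subCo cat qCo pCo) setIC.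
- by move=> a; split; apply: image_sub; [exact: (dom_Co cat) | exact: (cod_Co cat)].
- by move=> p pCo; split; apply: Omega_eq;
    [exact: (image_dom_subCo cat) | exact: (image_cod_subCo cat)].
- by move=> a; split; apply: Omega_eq;
    [exact: (set_prod_image_dom cat) | exact: (set_prod_image_cod cat)].
- by move=> a b; split; apply: Omega_eq;
    [exact: (image_dom_set_prod cat) | exact: (image_cod_set_prod cat)].
Qed.

Lemma Omega_dom_cod_lub (S : set (Omega C)) j : is_lub incl S j ->
  is_lub incl (Omega_dom @` S) (Omega_dom j) /\
  is_lub incl (Omega_cod @` S) (Omega_cod j).
Proof.
move=> /is_lub_OmegaE jE.
by split; apply/is_lub_OmegaE; rewrite /= jE bigcup_image; exact: image_bigcup.
Qed.

Lemma partial_isometry_OmegaE a :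
  pi a <-> set_inj (proj1_sig a) dom /\ set_inj (proj1_sig a) cod.
Proof.
split=> [pia|[injd injc] b ba]; last first.
  split; apply: Omega_eq; apply/esym.
  - exact: (set_prod_image_cod_subset cat).
  - exact: (set_prod_image_dom_subset cat).
have oa := proj2_sig a.
split; [apply: (set_inj_dom_restrictions etale) |
        apply: (set_inj_cod_restrictions etale)] => // B oB Ba.
- by have [_ /(f_equal (@proj1_sig _ _))] := pia (exist _ _ oB) Ba.
- by have [/(f_equal (@proj1_sig _ _))] := pia (exist _ _ oB) Ba.
Qed.

Lemma Omega_top_is_lub_pi : is_lub incl pi (exist _ _ (@openT C)).
Proof.
split=> [//|u ub x _].
have [W1 [oW1 W1x injW1]] := local_homeo_locally_inj dom_lh x.
have [W2 [oW2 W2x injW2]] := local_homeo_locally_inj cod_lh x.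
apply: (ub (exist _ _ (openI oW1 oW2))) => //.
apply/partial_isometry_OmegaE; split.
- by move=> y z /set_mem[? _] /set_mem[? _]; apply: injW1; exact: mem_set.
- by move=> y z /set_mem[_ ?] /set_mem[_ ?]; apply: injW2; exact: mem_set.
Qed.

Lemma partial_isometry_Omega_mul a b : pi a -> pi b -> pi (Omega_mul a b).
Proof.
move=> /partial_isometry_OmegaE[da ca] /partial_isometry_OmegaE[db cb].
by apply/partial_isometry_OmegaE; split;
  [exact: (set_inj_dom_set_prod cat) | exact: (set_inj_cod_set_prod cat)].
Qed.

Lemma Omega_restriction_quantal_frame :
  is_restriction_quantal_frame incl Omega_mul Omega_id Omega_dom Omega_cod.
Proof.
split.
- by split; [exact: Omega_quantal_frame | exact: Omega_mul_id].
- exact: Omega_ehresmann.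
- exact: Omega_dom_cod_lub.
- by exists (exist _ _ (@openT C)); split; [move=> x | exact: Omega_top_is_lub_pi].
- exact: partial_isometry_Omega_mul.
Qed.

End OmegaRestrictionQuantalFrame.

Unset Implicit Arguments.

Theorem mainTheorem3 (C : topologicalType) (Co : set C) (dom cod : C -> C)
    (mul : C -> C -> C) :
  is_etale_category Co dom cod mul ->
  exists (mulO : Omega C -> Omega C -> Omega C) (eO : Omega C)
         (starO plusO : Omega C -> Omega C),
    [/\ (forall U V : Omega C,
           proj1_sig (mulO U V) = set_prod dom cod mul (proj1_sig U) (proj1_sig V)),
        proj1_sig eO = Co,
        (forall U : Omega C, proj1_sig (starO U) = dom @` (proj1_sig U)),
        (forall U : Omega C, proj1_sig (plusO U) = cod @` (proj1_sig U)) &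
        is_restriction_quantal_frame
          (fun U V : Omega C => proj1_sig U `<=` proj1_sig V)
          mulO eO starO plusO].
Proof.
move=> etale.
exists (Omega_mul etale), (Omega_id etale), (Omega_dom etale), (Omega_cod etale).
by split => //; exact: Omega_restriction_quantal_frame.
Qed.
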